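(* Let $\Bbbk$ be a PID with fraction field of characteristic zero. Let $S=S^0\oplus S^1\oplus\dots\oplus S^N$ be a graded $\Bbbk$-algebra and let $T=T^0\oplus T^1\oplus\dots\oplus T^N\subseteq S$ be a full rank graded $\Bbbk$-subalgebra with $T^0=S^0$. Suppose $T$ possesses a degree $-N$ symmetrizing form. Let $C$ be a $\Bbbk$-subalgebra of $S$ (not assumed to be a graded subalgebra) containing $T$ and such that for every maximal ideal $\mathfrak{m}$ of $\Bbbk$ the $(\Bbbk/\mathfrak{m})$-algebra $C_{\Bbbk/\mathfrak{m}}$ is symmetric. Suppose that there is $\xi\in S^0$ such that: (a) each $y\in S^N$ can be written in the form $y=y_1+y_2$ with $\xi y_1=0$ and $y_2\in T^N$; (b) $1_{\Bbbk/\mathfrak{m}}\otimes\xi$ is a quasi-unit in $S^0_{\Bbbk/\mathfrak{m}}$ for every maximal ideal $\mathfrak{m}$ of $\Bbbk$. Then $C=T$.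
   Context: All $\Bbbk$-algebras are (associative,) unital and free of finite rank as $\Bbbk$-modules; subalgebras are unital (they share the identity element of the ambient algebra). For a field $\mathbb{F}$ that is a $\Bbbk$-module via a ring homomorphism $\Bbbk\to\mathbb{F}$ and a $\Bbbk$-algebra $A$, write $A_{\mathbb{F}}:=\mathbb{F}\otimes_\Bbbk A$, an $\mathbb{F}$-algebra. Symmetric algebra: for a commutative ring $R$, an $R$-algebra $A$ (free of finite rank) is symmetric if it possesses a symmetrizing form, i.e. an $R$-linear form $\mathsf{t}:A\to R$ such that the bilinear form $(a,b)_{\mathsf t}:=\mathsf{t}(ab)$ is a symmetric perfect pairing: $(a,b)_{\mathsf t}=(b,a)_{\mathsf t}$ for all $a,b\in A$, and $A\to\operatorname{Hom}_R(A,R)$, $a\mapsto(a,\cdot)_{\mathsf t}$, is an isomorphism of $R$-modules. Grading: $S=S^0\oplus\dots\oplus S^N$ graded means $S^iS^j\subseteq S^{i+j}$ (with $S^k=0$ for $k>N$); in particular $S^0$ is a subalgebra. A graded subalgebra $T=T^0\oplus\dots\oplus T^N$ has $T^i=T\cap S^i$ for all $i$. It is of full rank if $\operatorname{rank}_\Bbbk T^i=\operatorname{rank}_\Bbbk S^i$ for all $i$. A degree $-N$ symmetrizing form on $T$ is a symmetrizing form $\mathsf{t}$ on $T$ such that $\mathsf{t}|_{T^i}=0$ unless $i=N$. The symmetrizing forms on the algebras $C_{\Bbbk/\mathfrak m}$ are not assumed to be related to the form on $T$. Quasi-unit: an element $\xi$ of a unital ring $A$ is a quasi-unit if, for every central $z\in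 A$, $\xi\in Az$ implies that $z$ is a unit. *)

(* Defs.v *)
From HB Require Import structures.
From mathcomp Require Import all_boot all_order all_algebra.
From mathcomp Require Import boolp.

Set Implicit Arguments.
Unset Strict Implicit.
Unset Printing Implicit Defensive.

Import GRing.Theory.
Local Open Scope ring_scope.
Local Open Scope quotient_scope.

(* The submodule U has a basis with n elements. *)
Definition free_of_rank (R : pzRingType) (V : lmodType R) (U : {pred V})
    (n : nat) : Prop :=
  exists b : 'I_n -> V,
    (forall i, b i \in U) /\
    (forall x, x \in U ->
       exists! c : {ffun 'I_n -> R}, x = \sum_(i < n) c i *: b i).

(* Algebras are free of finite rank, and so are subalgebras.  Over a PID the
   latter is automatic. *)
HB.mixin Record isFinFree (R : pzRingType) V of GRing.Lmodule R V := {
  fin_free : exists n, free_of_rank (V := V) predT n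
}.

#[short(type="finFreeAlgType")]
HB.structure Definition FinFreeAlgebra (R : pzRingType) :=
  {A of GRing.Algebra R A & isFinFree R A}.

HB.mixin Record isFinFreeSub (R : pzRingType) (V : lmodType R)
    (U : V -> bool) := {
  fin_free_sub : exists n, free_of_rank (V := V) U n
}.

#[short(type="finFreeSubalgClosed")]
HB.structure Definition FinFreeSubalgClosed (R : pzRingType)
    (A : algType R) :=
  {B of @GRing.SubalgClosed R A B & isFinFreeSub R A B}.

Section SubalgebraType.
Variables (R : pzRingType) (A : algType R) (B : finFreeSubalgClosed A).

Record subalg := Subalg { subalg_val : A; _ : subalg_val \in B }.

HB.instance Definition _ := [isSub for subalg_val].
HB.instance Definition _ := [Choice of subalg by <:].
HB.instance Definition _ := [SubChoice_isSubAlgebra of subalg by <:].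

Fact subalg_fin_free : exists n, free_of_rank (V := subalg) predT n.
Proof.
have [n [b [bB bP]]] := fin_free_sub (s := B).
exists n, (fun i => Subalg (bB i)); split=> // x _.
have sumE (c : {ffun 'I_n -> R}) :
    \val (\sum_i c i *: Subalg (bB i)) = \sum_i c i *: b i.
  rewrite raddf_sum.
  by apply: eq_bigr.
have [c [cE cU]] := bP _ (valP x).
exists c; split=> [|c' c'E]; first by apply: val_inj; rewrite sumE.
by apply: cU; rewrite -sumE -c'E.
Qed.

HB.instance Definition _ := isFinFree.Build R subalg subalg_fin_free.

End SubalgebraType.

Section BaseChange.
Variables (R F : comNzRingType) (phi : {rmorphism R -> F}).
Variable A : finFreeAlgType R.

Definition balanced (G : zmodType) (beta : F -> A -> G) : Prop :=
  [/\ forall f, {morph beta f : a a' / a + a'},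
      forall a, {morph beta^~ a : f f' / f + f'} &
      forall r f a, beta (phi r * f) a = beta f (r *: a)].

Definition formal_eval (G : zmodType) (beta : F -> A -> G)
  (s : seq (F * A)) : G := \sum_(p <- s) beta p.1 p.2.

(* A formal sum of pairs stands for a sum of pure tensors; two of them are
   identified iff no balanced map separates them. *)
Definition formal_equiv (s s' : seq (F * A)) : bool :=
  `[< forall (G : zmodType) (beta : F -> A -> G),
        balanced beta -> formal_eval beta s = formal_eval beta s' >].

Fact formal_equiv_is_equiv : equiv_class_of formal_equiv.
Proof.
split.
- by move=> s; apply/asboolP.
- by move=> s s'; apply/asboolP/asboolP => h G beta hb; rewrite h.
- move=> s2 s1 s3 /asboolP h /asboolP h'; apply/asboolP => G beta hb.
  by rewrite h // h'.
Qed.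

Canonical formal_equiv_equiv := EquivRelPack formal_equiv_is_equiv.
Canonical formal_equiv_encModRel := defaultEncModRel formal_equiv.

(* F (x)_R A, where F is an R-module through phi. *)
Definition base_change := {eq_quot formal_equiv}.

HB.instance Definition _ := EqQuotient.on base_change.
HB.instance Definition _ := Choice.on base_change.

Definition bc_pi (s : seq (F * A)) : base_change := \pi_base_change s.

(* The additive map induced on F (x)_R A by a balanced map. *)
Definition bc_lift (G : zmodType) (beta : F -> A -> G) (x : base_change) : G :=
  formal_eval beta (repr x).

Lemma bc_lift_pi (G : zmodType) (beta : F -> A -> G) s :
  balanced beta -> bc_lift beta (bc_pi s) = formal_eval beta s.
Proof.
move=> hb; rewrite /bc_lift /bc_pi.
have /eqmodP/asboolP -> // : repr (\pi_base_change s) = s %[mod base_change].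
by rewrite reprK.
Qed.

Lemma bc_ext (x y : base_change) :
  (forall (G : zmodType) (beta : F -> A -> G),
     balanced beta -> bc_lift beta x = bc_lift beta y) -> x = y.
Proof.
move=> h; rewrite -[x]reprK -[y]reprK; apply/eqmodP/asboolP => G beta hb.
exact: h.
Qed.

Lemma eq_bc_lift (G : zmodType) (beta beta' : F -> A -> G) x :
  beta =2 beta' -> bc_lift beta x = bc_lift beta' x.
Proof. by move=> e; apply: eq_bigr => p _; apply: e. Qed.

Lemma bc_lift_additive (G : zmodType) (beta beta' : F -> A -> G) x :
  bc_lift (fun f a => beta f a + beta' f a) x =
  bc_lift beta x + bc_lift beta' x.
Proof. by rewrite /bc_lift /formal_eval big_split. Qed.

Definition tens (f : F) (a : A) : base_change := bc_pi [:: (f, a)].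
Definition bc_zero : base_change := bc_pi [::].
Definition bc_add (x y : base_change) := bc_pi (repr x ++ repr y).
Definition bc_scale (c : F) (x : base_change) :=
  bc_pi [seq (c * p.1, p.2) | p <- repr x].
Definition bc_opp (x : base_change) := bc_scale (-1) x.
(* (f (x) a) (f' (x) a') = f f' (x) a a' *)
Definition bc_mul (x y : base_change) :=
  bc_pi [seq (p.1 * q.1, p.2 * q.2) | p <- repr x, q <- repr y].

Section Eval.
Variables (G : zmodType) (beta : F -> A -> G).
Hypothesis hb : balanced beta.

Lemma balanced0 a : beta 0 a = 0.
Proof.
have [_ hD _] := hb; apply: (addrI (beta 0 a)).
by rewrite -[in LHS](hD a) !addr0.
Qed.

Lemma balancedN f a : beta (- f) a = - beta f a.
Proof.
have [_ hD _] := hb; apply: (addrI (beta f a)).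
by rewrite -(hD a) !subrr balanced0.
Qed.

Lemma balanced_scale c : balanced (fun f a => beta (c * f) a).
Proof.
have [h1 h2 h3] := hb; split=> [f a a'|a f f'|r f a] /=.
- by rewrite h1.
- by rewrite mulrDr h2.
- by rewrite mulrCA h3.
Qed.

Lemma balanced_mull f' a' : balanced (fun f a => beta (f * f') (a * a')).
Proof.
have [h1 h2 h3] := hb; split=> [f a b|a f g|r f a] /=.
- by rewrite mulrDl h1.
- by rewrite mulrDl h2.
- by rewrite -mulrA h3 scalerAl.
Qed.

Lemma balanced_mulr f' a' : balanced (fun f a => beta (f' * f) (a' * a)).
Proof.
have [h1 h2 h3] := hb; split=> [f a b|a f g|r f a] /=.
- by rewrite mulrDr h1.
- by rewrite mulrDr h2.
- by rewrite mulrCA h3 scalerAr.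
Qed.

Lemma bc_lift_mul_balanced y :
  balanced (fun f a => bc_lift (fun f' a' => beta (f * f') (a * a')) y).
Proof.
split=> [f a b|a f g|r f a] /=.
- rewrite -bc_lift_additive; apply: eq_bc_lift => f' a'.
  by have [h1 _ _] := balanced_mull f' a'; apply: h1.
- rewrite -bc_lift_additive; apply: eq_bc_lift => f' a'.
  by have [_ h2 _] := balanced_mull f' a'; apply: h2.
- apply: eq_bc_lift => f' a'.
  by have [_ _ h3] := balanced_mull f' a'; apply: h3.
Qed.

Lemma bc_lift_tens f a : bc_lift beta (tens f a) = beta f a.
Proof. by rewrite bc_lift_pi // /formal_eval big_seq1. Qed.

Lemma bc_lift0 : bc_lift beta bc_zero = 0.
Proof. by rewrite bc_lift_pi // /formal_eval big_nil. Qed.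

Lemma bc_liftD x y :
  bc_lift beta (bc_add x y) = bc_lift beta x + bc_lift beta y.
Proof. by rewrite bc_lift_pi // /formal_eval big_cat. Qed.

Lemma bc_liftZ c x :
  bc_lift beta (bc_scale c x) = bc_lift (fun f a => beta (c * f) a) x.
Proof. by rewrite bc_lift_pi // /formal_eval big_map. Qed.

Lemma bc_liftN x : bc_lift beta (bc_opp x) = - bc_lift beta x.
Proof.
rewrite bc_liftZ /bc_lift /formal_eval -sumrN.
by apply: eq_bigr => p _; rewrite mulN1r balancedN.
Qed.

Lemma bc_liftM x y :
  bc_lift beta (bc_mul x y) =
  bc_lift (fun f a => bc_lift (fun f' a' => beta (f * f') (a * a')) y) x.
Proof. by rewrite bc_lift_pi // /formal_eval big_allpairs_dep. Qed.

End Eval.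

Fact bc_addA : associative bc_add.
Proof. by move=> x y z; apply: bc_ext => G b hb; rewrite !bc_liftD ?addrA. Qed.

Fact bc_addC : commutative bc_add.
Proof. by move=> x y; apply: bc_ext => G b hb; rewrite !bc_liftD // addrC. Qed.

Fact bc_add0 : left_id bc_zero bc_add.
Proof.
by move=> x; apply: bc_ext => G b hb; rewrite bc_liftD // bc_lift0 // add0r.
Qed.

Fact bc_addN : left_inverse bc_zero bc_opp bc_add.
Proof.
move=> x; apply: bc_ext => G b hb.
by rewrite bc_liftD // bc_liftN // bc_lift0 // addNr.
Qed.

HB.instance Definition _ :=
  GRing.isZmodule.Build base_change bc_addA bc_addC bc_add0 bc_addN.

Fact bc_mulA : associative bc_mul.
Proof.
move=> x y z; apply: bc_ext => G b hb.
rewrite bc_liftM // [RHS]bc_liftM //.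
rewrite [RHS]bc_liftM; last exact: bc_lift_mul_balanced.
apply: eq_bc_lift => f a; rewrite bc_liftM; last exact: balanced_mulr.
apply: eq_bc_lift => f' a'; apply: eq_bc_lift => f'' a''.
by rewrite !mulrA.
Qed.

Fact bc_mul1 : left_id (tens 1 1) bc_mul.
Proof.
move=> x; apply: bc_ext => G b hb; rewrite bc_liftM // bc_lift_tens.
  by apply: eq_bc_lift => f a; rewrite !mul1r.
exact: bc_lift_mul_balanced.
Qed.

Fact bc_mulr1 : right_id (tens 1 1) bc_mul.
Proof.
move=> x; apply: bc_ext => G b hb; rewrite bc_liftM //.
apply: eq_bc_lift => f a; rewrite bc_lift_tens ?mulr1 //.
exact: balanced_mulr.
Qed.

Fact bc_mulDl : left_distributive bc_mul +%R.
Proof.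
move=> x y z; apply: bc_ext => G b hb.
rewrite bc_liftM // bc_liftD; last exact: bc_lift_mul_balanced.
by rewrite bc_liftD // !bc_liftM.
Qed.

Fact bc_mulDr : right_distributive bc_mul +%R.
Proof.
move=> x y z; apply: bc_ext => G b hb.
rewrite bc_liftD // !bc_liftM // -bc_lift_additive.
apply: eq_bc_lift => f a; rewrite bc_liftD //; exact: balanced_mulr.
Qed.

(* In coordinates c_i with respect to a basis, (f, a) |-> f * phi (c_i a) is
   balanced. *)
Lemma coord_balanced :
  exists n (b : 'I_n -> A) (coord : 'I_n -> A -> F),
    [/\ forall i, balanced (fun f a => f * coord i a : F),
        forall i j, coord i (b j) = (i == j)%:R &
        forall a, exists c : 'I_n -> R,
          a = \sum_i c i *: b i /\ forall i, coord i a = phi (c i)].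
Proof.
have [n [b [_ bP]]] := fin_free (s := A).
have [c cP] := boolp.choice (fun a => bP a isT).
have cE a (d : 'I_n -> R) : a = \sum_i d i *: b i -> c a =1 d.
  move=> e i; have [_ /(_ [ffun i => d i])->] := cP a; first by rewrite ffunE.
  by rewrite e; apply: eq_bigr => j _; rewrite ffunE.
have cD a a' i : c (a + a') i = c a i + c a' i.
  apply: (cE _ (fun i => c a i + c a' i)).
  rewrite {1}[a](proj1 (cP a)) {1}[a'](proj1 (cP a')) -big_split /=.
  by apply: eq_bigr => j _; rewrite scalerDl.
have cZ r a i : c (r *: a) i = r * c a i.
  apply: (cE _ (fun i => r * c a i)).
  rewrite {1}[a](proj1 (cP a)) scaler_sumr.
  by apply: eq_bigr => j _; rewrite scalerA.
exists n, b, (fun i a => phi (c a i)); split.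
- move=> i; split=> [f a a'|a f f'|r f a] /=.
  + by rewrite cD rmorphD mulrDr.
  + by rewrite mulrDl.
  + by rewrite cZ rmorphM mulrCA mulrA.
- move=> i j; rewrite (cE _ (fun i => (i == j)%:R)) ?rmorph_nat //.
  rewrite (bigD1 j) //= eqxx scale1r big1 ?addr0 // => l /negPf->.
  by rewrite scale0r.
- by move=> a; exists (c a); split=> //; apply: (proj1 (cP a)).
Qed.

Fact bc_oner_neq0 : tens 1 1 != 0.
Proof.
apply/eqP => e.
have [n [b [co [cob cobE coE]]]] := coord_balanced.
have [c [oneE _]] := coE 1.
have i0 : 'I_n.
  case: n b co cob cobE coE c oneE => [|n]; last by move=> *; exact: ord0.
  by move=> b co _ _ _ c /eqP; rewrite big_ord0 oner_eq0.
have : bc_mul (tens 1 1) (tens 1 (b i0)) = bc_mul 0 (tens 1 (b i0)).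
  by rewrite e.
move/(congr1 (bc_lift (fun f a => f * co i0 a))).
rewrite bc_mul1 bc_lift_tens // bc_liftM // bc_lift0; last first.
  exact: (bc_lift_mul_balanced (cob i0)).
by rewrite cobE eqxx mul1r => /eqP; rewrite oner_eq0.
Qed.

HB.instance Definition _ := GRing.Zmodule_isNzRing.Build base_change
  bc_mulA bc_mul1 bc_mulr1 bc_mulDl bc_mulDr bc_oner_neq0.

Fact bc_scaleA c d (x : base_change) :
  bc_scale c (bc_scale d x) = bc_scale (c * d) x.
Proof.
apply: bc_ext => G b hb; rewrite !bc_liftZ //; last exact: balanced_scale.
by apply: eq_bc_lift => f a; rewrite mulrA mulrAC -mulrA mulrCA.
Qed.

Fact bc_scale1 : left_id 1 bc_scale.
Proof.
move=> x; apply: bc_ext => G b hb; rewrite bc_liftZ //.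
by apply: eq_bc_lift => f a; rewrite mul1r.
Qed.

Fact bc_scaleDr : right_distributive bc_scale +%R.
Proof.
move=> c x y; apply: bc_ext => G b hb.
by rewrite bc_liftZ // !bc_liftD ?bc_liftZ //; exact: balanced_scale.
Qed.

Fact bc_scaleDl x : {morph bc_scale^~ x : c d / c + d}.
Proof.
move=> c d; apply: bc_ext => G b hb.
rewrite bc_liftZ // bc_liftD // !bc_liftZ // -bc_lift_additive.
apply: eq_bc_lift => f a; have [_ h2 _] := hb.
by rewrite mulrDl h2.
Qed.

HB.instance Definition _ := GRing.Zmodule_isLmodule.Build F base_change
  bc_scaleA bc_scale1 bc_scaleDr bc_scaleDl.

Fact bc_scalerAl (c : F) (x y : base_change) : c *: (x * y) = (c *: x) * y.
Proof.
apply: bc_ext => G b hb; rewrite bc_liftZ // bc_liftM; last first.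
  exact: balanced_scale.
rewrite bc_liftM // bc_liftZ; last exact: bc_lift_mul_balanced.
by apply: eq_bc_lift => f a; apply: eq_bc_lift => f' a'; rewrite mulrA.
Qed.

HB.instance Definition _ :=
  GRing.Lmodule_isLalgebra.Build F base_change bc_scalerAl.

Fact bc_scalerAr (c : F) (x y : base_change) : c *: (x * y) = x * (c *: y).
Proof.
apply: bc_ext => G b hb; rewrite bc_liftZ // bc_liftM; last first.
  exact: balanced_scale.
rewrite bc_liftM //; apply: eq_bc_lift => f a; rewrite bc_liftZ.
  by apply: eq_bc_lift => f' a'; rewrite mulrCA.
exact: balanced_mulr.
Qed.

HB.instance Definition _ :=
  GRing.Lalgebra_isAlgebra.Build F base_change bc_scalerAr.

Lemma tens_balanced : balanced tens.
Proof.
split=> [f a a'|a f f'|r f a] /=; apply: bc_ext => G b hb;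
  have [h1 h2 h3] := hb.
- by rewrite bc_liftD // !bc_lift_tens // h1.
- by rewrite bc_liftD // !bc_lift_tens // h2.
- by rewrite !bc_lift_tens // h3.
Qed.

Lemma bc_lift_is_additive (G : zmodType) (beta : F -> A -> G) :
  balanced beta -> {morph bc_lift beta : x y / x + y}.
Proof. by move=> hb x y; apply: bc_liftD. Qed.

Lemma tens_scale c f a : c *: tens f a = tens (c * f) a.
Proof.
apply: bc_ext => G b hb; rewrite bc_liftZ // !bc_lift_tens //.
exact: balanced_scale.
Qed.

Lemma tens_mul f a f' a' : tens f a * tens f' a' = tens (f * f') (a * a').
Proof.
apply: bc_ext => G b hb; rewrite bc_liftM // !bc_lift_tens //.
  exact: balanced_mulr.
exact: bc_lift_mul_balanced.
Qed.

Lemma tens_span (x : base_change) : exists s : seq (F * A),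
  x = \sum_(p <- s) tens p.1 p.2.
Proof.
exists (repr x); rewrite -[LHS]reprK; elim: (repr x) => [|p s IHs].
  by rewrite big_nil.
rewrite big_cons -IHs; apply: bc_ext => G b hb.
by rewrite bc_liftD // !bc_lift_pi // /formal_eval big_cons big_seq1.
Qed.

Fact base_change_fin_free :
  exists n, free_of_rank (V := base_change) predT n.
Proof.
have [n [b [co [cob cobE coE]]]] := coord_balanced.
exists n, (fun i => tens 1 (b i)); split=> // x _.
have liftE (c : {ffun 'I_n -> F}) i :
    bc_lift (fun f a => f * co i a) (\sum_j c j *: tens 1 (b j)) = c i.
  rewrite (big_morph _ (bc_lift_is_additive (cob i)) (bc_lift0 (cob i))).
  rewrite (bigD1 i) //= tens_scale bc_lift_tens // mulr1 cobE eqxx mulr1.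
  rewrite big1 ?addr0 // => j /negPf ji.
  by rewrite tens_scale bc_lift_tens // cobE eq_sym ji mulr0.
have [c cE] : exists c : {ffun 'I_n -> F}, x = \sum_i c i *: tens 1 (b i).
  have [s ->] := tens_span x.
  elim: s => [|[f a] s [c IHs]].
    exists [ffun=> 0]; rewrite big_nil big1 // => i _.
    by rewrite ffunE scale0r.
  have [d [aE _]] := coE a.
  exists [ffun i => f * phi (d i) + c i]; rewrite big_cons IHs.
  under [RHS]eq_bigr => i _ do rewrite ffunE scalerDl.
  rewrite big_split /=; congr (_ + _).
  have [h1 h2 h3] := tens_balanced.
  have t0 : tens f 0 = 0.
    by apply: (addrI (tens f 0)); rewrite -h1 !addr0.
  rewrite {1}aE (big_morph (tens f) (h1 f) t0).
  by apply: eq_bigr => i _; rewrite -h3 tens_scale mulr1 mulrC.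
exists c; split=> // c' c'E; apply/ffunP => i.
by rewrite -(liftE c i) -(liftE c' i) -cE -c'E.
Qed.

HB.instance Definition _ := isFinFree.Build F base_change base_change_fin_free.

End BaseChange.

(* m, of type idealr, is already proper. *)
Definition maximal_ideal (R : comNzRingType) (m : idealr R) : Prop :=
  forall I : idealr R, {subset m <= I} -> I =i m.

Definition principal_ideal_ring (R : comNzRingType) : Prop :=
  forall I : {pred R},
    0 \in I -> (forall r, {in I &, forall x y, r * x + y \in I}) ->
    exists g, forall x, (x \in I) <-> (exists r, x = r * g).

Section Residue.
Variables (R : comNzRingType) (m : idealr R) (A : finFreeAlgType R).

Definition residue_map : {rmorphism R -> {ideal_quot m}} :=
  \pi_({ideal_quot m}).

Definition residue_algebra := base_change residue_map A.

HB.instance Definition _ := FinFreeAlgebra.on residue_algebra.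

Definition residue_tens : {ideal_quot m} -> A -> residue_algebra :=
  @tens _ _ residue_map A.

End Residue.

Arguments residue_algebra {R} m A.
Arguments residue_tens {R} m {A} _ _.

(* The second clause is bijectivity of a |-> (b |-> t (a * b)) onto the
   R-linear forms on A. *)
Definition symmetrizing_form (R : comNzRingType) (A : finFreeAlgType R)
    (t : {linear A -> R^o}) : Prop :=
  (forall a b, t (a * b) = t (b * a)) /\
  (forall f : {linear A -> R^o}, exists! a, forall b, t (a * b) = f b).

Definition symmetric_algebra (R : comNzRingType) (A : finFreeAlgType R) : Prop :=
  exists t : {linear A -> R^o}, symmetrizing_form t.

Definition quasi_unit (A : nzRingType) (xi : A) : Prop :=
  forall z : A, (forall a, z * a = a * z) ->
    (exists a, xi = a * z) -> exists w, w * z = 1 /\ z * w = 1.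

(* Components are indexed by all of nat and vanish above N.  Their freeness,
   automatic over a PID, is what makes component 0 a subalgebra that is free of
   finite rank. *)
Record grading (R : pzRingType) (A : algType R) (N : nat) := Grading {
  component :> nat -> submodClosed A;
  component_free : forall i, exists n, free_of_rank (component i) n;
  component_gt : forall i x, (N < i)%N -> x \in component i -> x = 0;
  componentM : forall i j x y,
    x \in component i -> y \in component j -> x * y \in component (i + j)%N;
  component_direct : forall x, exists! s : {ffun 'I_N.+1 -> A},
    (forall i, s i \in component i) /\ x = \sum_(i < N.+1) s i
}.

Section DegreeZero.
Variables (R : pzRingType) (A : algType R) (N : nat) (Ag : grading A N).

Definition degree0 : A -> bool := fun x => x \in Ag 0%N.

Fact degree0_one : 1 \in Ag 0%N.
Proof.
have [s [[sA oneE] _]] := component_direct Ag 1.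
suff -> : 1 = s ord0 by apply: (sA ord0).
have unitl j x : (j <= N)%N -> x \in Ag j -> s ord0 * x = x.
  move=> jN xj.
  pose u : {ffun 'I_N.+1 -> A} :=
    [ffun k : 'I_N.+1 => if (k : nat) == j then x else 0].
  pose v : {ffun 'I_N.+1 -> A} :=
    [ffun k : 'I_N.+1 => if (j <= k)%N then s (inord (k - j)) * x else 0].
  have jlt : (j < N.+1)%N by [].
  have [w [_ wU]] := component_direct Ag x.
  have uE : w = u.
    apply: wU; split=> [k|].
      by rewrite ffunE; case: eqP => [->|_] //; apply: rpred0.
    rewrite (bigD1 (Ordinal jlt)) //= ffunE eqxx big1 ?addr0 // => k kj.
    by rewrite ffunE -val_eqE /= in kj *; rewrite (negPf kj).
  have vE : w = v.
    apply: wU; split=> [k|].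
      rewrite ffunE; case: leqP => [jk|_]; last exact: rpred0.
      rewrite -[X in Ag X](subnK jk); apply: componentM => //.
      have := sA (inord (k - j)); rewrite inordK //.
      by rewrite ltnS (leq_trans (leq_subr _ _)) // -ltnS.
    rewrite -[LHS]mul1r oneE mulr_suml.
    pose f k := if (k < N.+1)%N then s (inord k) * x else 0.
    have f0 k : (N < k + j)%N -> f k = 0.
      rewrite /f => kj; case: (ltnP k N.+1) => // kN.
      apply: (component_gt (g := Ag) kj); apply: componentM => //.
      by have := sA (inord k); rewrite inordK.
    transitivity (\sum_(0 <= k < N.+1) f k).
      rewrite big_mkord; apply: eq_bigr => k _.
      by rewrite /f ltn_ord inord_val.
    rewrite (big_cat_nat (n := (N.+1 - j)%N)) ?leq_subr //=.
    rewrite [X in _ + X]big1_seq ?addr0; last first.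
      move=> k /=; rewrite mem_index_iota => /andP[kN _].
      by apply: f0; rewrite addnC -leq_subLR subSn in kN *.
    transitivity (\sum_(0 <= k < N.+1)
        if (j <= k)%N then s (inord (k - j)) * x else 0); last first.
      by rewrite big_mkord; apply: eq_bigr => k _; rewrite ffunE.
    rewrite [RHS](big_cat_nat (n := j)) ?(ltnW jlt) //=.
    rewrite [X in _ = X + _]big1_seq ?add0r; last first.
      move=> k /=; rewrite mem_index_iota => /andP[_ kj].
      by rewrite leqNgt kj.
    rewrite -{2}[j]add0n big_addn; apply: eq_big_nat => k /andP[_ kN].
    rewrite leq_addl addnK /f ifT //.
    exact: leq_trans kN (leq_subr _ _).
  have := congr1 (fun g : {ffun 'I_N.+1 -> A} => g (Ordinal jlt)) (etrans (esym uE) vE).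
  rewrite !ffunE /= eqxx leqnn subnn => xE; rewrite [RHS]xE.
  by congr (s _ * _); apply: val_inj; rewrite /= inordK.
rewrite -[RHS]mulr1 [X in s ord0 * X]oneE mulr_sumr.
transitivity (\sum_i s i) => //; apply: eq_bigr => i _.
by rewrite (unitl i) // -ltnS.
Qed.

Fact degree0_closed : GRing.subsemialg_closed degree0.
Proof.
split; first exact: degree0_one.
- by split; [apply: (rpred0 (Ag 0%N))|apply: (rpredD (S := Ag 0%N))].
- by move=> c x; apply: (rpredZ (s := Ag 0%N)).
- by move=> x y x0 y0; apply: (@componentM _ _ _ Ag 0 0).
Qed.

HB.instance Definition _ := GRing.isSubalgClosed.Build R A degree0 degree0_closed.
HB.instance Definition _ := isFinFreeSub.Build R A degree0 (component_free Ag 0).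

Definition degree0_subalg : finFreeSubalgClosed A :=
  FinFreeSubalgClosed.clone R A degree0 _.

End DegreeZero.

Section GradedSubalgebra.
Variables (R : pzRingType) (A : algType R) (N : nat) (Ag : grading A N).
Variable B : finFreeSubalgClosed A.

Definition sub_component (i : nat) : {pred A} :=
  [pred x | (x \in B) && (x \in Ag i)].

Definition graded_subalgebra : Prop :=
  forall x, x \in B -> exists s : {ffun 'I_N.+1 -> A},
    (forall i : 'I_N.+1, s i \in sub_component i) /\ x = \sum_(i < N.+1) s i.

Definition full_rank : Prop :=
  forall i, (i <= N)%N ->
    exists n, free_of_rank (sub_component i) n /\ free_of_rank (Ag i) n.

End GradedSubalgebra.

(* A symmetrizing form on the graded subalgebra B that is zero on all its
   components except the one of degree N. *)
Definition degree_opp_symmetrizing_form (R : comNzRingType) (A : algType R)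
    (N : nat) (Ag : grading A N) (B : finFreeSubalgClosed A)
    (t : {linear subalg B -> R^o}) : Prop :=
  symmetrizing_form t /\
  (forall i (x : subalg B), i <> N -> \val x \in Ag i -> t x = 0).

(* Main.v *)
Require Import Defs.
From HB Require Import structures.
From mathcomp Require Import all_boot all_order all_algebra.
From mathcomp Require Import boolp.

(** Since T has full rank in S, the quotient C / T is torsion, so it is enough
    to show that T meets p C only in p T for every generator p of a maximal
    ideal: [saturated].  (If x is in C, the scalars that multiply x into T form
    a principal ideal (g); were g not a unit, some such p would divide g, and
    g / p would multiply x into T as well.)

    Fix p and write F for the residue field.  The symmetrizing form of C_F
    restricts along T -> C to a trace form on T_F.  As T_F is symmetric with
    form t, this restriction is t (z * _) for some z central modulo p
    ([trace_multiplier], [multiplier_central]), and z kills everything in T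
    that becomes divisible by p in C.  So it is enough that z is invertible
    modulo p, and since elements of positive degree are nilpotent, that its
    degree-zero part z0 is.  The latter is central in S^0 modulo p, so by the
    quasi-unit hypothesis it remains to see that xi lies in S^0 z0 modulo p:
    [xi_multiple].

    The form t pairs T^0 = S^0 with T^N perfectly.  By duality over F
    ([residue_separation]) one has to show that t (xi * Y) vanishes modulo p
    for each Y in T^N such that t (Y * a * z0) does for all a in S^0.  For such
    Y the form of C_F vanishes on the image of Y T.  It even vanishes on that
    of Y C: only degree-zero parts survive multiplication by the top-degree
    element Y, and C and T have the same degree-zero parts because T^0 = S^0.
    Nondegeneracy makes Y = p c with c in C, and c is in S^N.  The
    decomposition of c given by the hypothesis on S^N turns xi * Y into p times
    an element of T, which is what was wanted.

    Apart from the two results that interpret the hypotheses on residue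
    algebras, [residue_symmetric] and [residue_quasi_unit], everything is
    carried out over k by congruences modulo p; this avoids comparing T_F,
    C_F and (S^0)_F with one another. *)

Set Implicit Arguments.
Unset Strict Implicit.
Unset Printing Implicit Defensive.

Import GRing.Theory.
Local Open Scope ring_scope.

(** * Coordinates and divisibility in free modules *)

Lemma linear_form_of (R : comNzRingType) (V : lmodType R) (f : V -> R) :
    (forall a x y, f (a *: x + y) = a * f x + f y) ->
  exists g : {linear V -> R^o}, g =1 f.
Proof.
move=> fL.
pose L := GRing.isLinear.Build R V R^o *:%R f fL.
by exists (HB.pack_for {linear V -> R^o} f L).
Qed.

Lemma dual_basis (R : comNzRingType) (A : finFreeAlgType R) :
  exists n (b : 'I_n -> A) (c : 'I_n -> {linear A -> R^o}),
    (forall a, a = \sum_i c i a *: b i) /\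
    (forall i j, c i (b j) = (i == j)%:R).
Proof.
have [n [b [_ bP]]] := fin_free (s := A).
have [c cP] := boolp.choice (fun a => bP a isT).
have cE a (d : 'I_n -> R) : a = \sum_i d i *: b i -> c a =1 d.
  move=> e i; have [_ /(_ [ffun i => d i])->] := cP a; first by rewrite ffunE.
  by rewrite e; apply: eq_bigr => j _; rewrite ffunE.
have cL i r a a' : c (r *: a + a') i = r * c a i + c a' i.
  apply: (cE _ (fun i => r * c a i + c a' i)).
  rewrite {1}[a](proj1 (cP a)) {1}[a'](proj1 (cP a')) scaler_sumr -big_split /=.
  by apply: eq_bigr => j _; rewrite scalerDl scalerA.
have [g gE] := boolp.choice (fun i => linear_form_of (cL i)).
exists n, b, g; split=> [a|i j].
  by rewrite {1}[a](proj1 (cP a)); apply: eq_bigr => i _; rewrite gE.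
rewrite gE (cE _ (fun i => (i == j)%:R)) // (bigD1 j) //= eqxx scale1r.
by rewrite big1 ?addr0 // => l /negPf->; rewrite scale0r.
Qed.

(** Stated for modules, so that it serves for scalars (with V = k^o) as well as
    for elements of an algebra. *)
Definition pdvd (R : pzRingType) (V : lmodType R) (p : R) (x : V) : Prop :=
  exists y, x = p *: y.

Section Pdvd.
Variables (R : comNzRingType) (p : R).

Lemma pdvd0 (V : lmodType R) : pdvd p (0 : V).
Proof. by exists 0; rewrite scaler0. Qed.

Lemma pdvdD (V : lmodType R) (x y : V) : pdvd p x -> pdvd p y -> pdvd p (x + y).
Proof. by move=> [x' ->] [y' ->]; exists (x' + y'); rewrite scalerDr. Qed.

Lemma pdvdZ (V : lmodType R) r (x : V) : pdvd p x -> pdvd p (r *: x).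
Proof. by move=> [x' ->]; exists (r *: x'); rewrite !scalerA mulrC. Qed.

Lemma pdvdN (V : lmodType R) (x : V) : pdvd p x -> pdvd p (- x).
Proof. by rewrite -scaleN1r; apply: pdvdZ. Qed.

Lemma pdvdB (V : lmodType R) (x y : V) : pdvd p x -> pdvd p y -> pdvd p (x - y).
Proof. by move=> px py; apply: pdvdD => //; apply: pdvdN. Qed.

Lemma pdvd_scale (V : lmodType R) (x : V) : pdvd p (p *: x).
Proof. by exists x. Qed.

Lemma pdvd_sum (V : lmodType R) n (f : 'I_n -> V) :
  (forall i, pdvd p (f i)) -> pdvd p (\sum_i f i).
Proof.
by move=> pf; elim/big_ind: _ => [|x y|i _] //; [exact: pdvd0|exact: pdvdD].
Qed.

Lemma pdvd_linear (V W : lmodType R) (f : {linear V -> W}) x :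
  pdvd p x -> pdvd p (f x).
Proof. by move=> [y ->]; rewrite linearZ; apply: pdvd_scale. Qed.

Lemma pdvd_mull (A : algType R) (a x : A) : pdvd p x -> pdvd p (a * x).
Proof. by move=> [y ->]; rewrite -scalerAr; apply: pdvd_scale. Qed.

End Pdvd.

Lemma linear_form_on_basis (R : comNzRingType) (A : finFreeAlgType R) :
  exists n (b : 'I_n -> A),
    (forall a, exists c : 'I_n -> R, a = \sum_i c i *: b i) /\
    (forall u : 'I_n -> R,
       exists f : {linear A -> R^o}, forall i, f (b i) = u i).
Proof.
have [n [b [c [cE cb]]]] := dual_basis A.
exists n, b; split=> [a|u]; first by exists (fun i => c i a).
have [|f fE] := @linear_form_of R A (fun a => \sum_i c i a * u i).
  move=> r a a'; rewrite mulr_sumr -big_split; apply: eq_bigr => i _ /=.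
  by rewrite linearD linearZ mulrDl mulrA.
exists f => i; rewrite fE (bigD1 i) //= cb eqxx mul1r big1 ?addr0 // => j ji.
by rewrite cb (negPf ji) mul0r.
Qed.

Section SymmetrizingForm.
Variables (R : comNzRingType) (A : finFreeAlgType R) (t : {linear A -> R^o}).
Hypothesis t_sym : symmetrizing_form t.

Lemma symmetrizing_form_inj a a' : (forall b, t (a * b) = t (a' * b)) -> a = a'.
Proof.
move=> e; have [|f fE] := @linear_form_of R A (fun b => t (a * b)).
  by move=> r x y; rewrite mulrDr linearD -scalerAr linearZ.
have [a0 [_ a0U]] := proj2 t_sym f.
by rewrite -(a0U a) 1?(a0U a') // => b; rewrite fE -?e.
Qed.

(** The pairing stays nondegenerate modulo p: the values t (a * e_i) / p on a
    basis define a linear form, and the element representing it is a / p. *)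
Lemma symmetrizing_form_pdvd p a :
  (forall b, pdvd p (t (a * b))) -> pdvd p a.
Proof.
move=> h; have [n [e [eS eL]]] := linear_form_on_basis A.
have /boolp.choice[u uE] i : exists y, t (a * e i) = p * y by apply: h.
have [f fE] := eL u; have [a' [a'E _]] := proj2 t_sym f.
exists a'; apply: symmetrizing_form_inj => b.
have [c ->] := eS b; rewrite !mulr_sumr !raddf_sum; apply: eq_bigr => i _ /=.
by rewrite -!scalerAr -scalerAl !linearZ /= uE a'E fE.
Qed.

End SymmetrizingForm.

(** * Maximal ideals of a principal ideal domain *)

Section MaximalIdeals.
Variable k : idomainType.
Implicit Types d e g p x : k.

Local Notation divides d x := (pdvd (V := k^o) d x).

Lemma divides_refl d : divides d d.
Proof. by exists 1; rewrite /GRing.scale /= mulr1. Qed.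

Lemma divides_trans d e x : divides d e -> divides e x -> divides d x.
Proof. by move=> [r ->] [s ->]; exists (r * s); rewrite scalerA. Qed.

Hypothesis k_pid : principal_ideal_ring k.

Lemma ideal_generator (I : {pred k}) :
    0 \in I -> (forall r, {in I &, forall x y, r * x + y \in I}) ->
  exists g, forall x, x \in I <-> divides g x.
Proof.
move=> I0 IP; have [g gP] := k_pid I0 IP; exists g => x.
by split=> [/gP[r ->]|[r ->]]; last apply/gP; exists r; rewrite mulrC.
Qed.

(** Otherwise every nonunit divisor of g would have a divisor generating a
    strictly larger proper ideal, and dependent choice would give a strictly
    ascending chain of principal ideals; but the union of the chain is
    principal, so its generator already lies in one of them. *)
Lemma maximal_divisor g : ~ divides g 1 -> exists p,
  [/\ divides p g, ~ divides p 1 &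
      forall d, divides d p -> ~ divides d 1 -> divides p d].
Proof.
move=> gU; apply: contrapT => noP.
pose X := {x | divides x g /\ ~ divides x 1}.
have step (x : X) : {y : X | divides (sval y) (sval x) /\
                             ~ divides (sval x) (sval y)}.
  apply: cid; case: x => x [xg xU] /=; apply: contrapT => noy.
  apply: noP; exists x; split=> // d dx dU; apply: contrapT => xd.
  by apply: noy; exists (exist _ d (conj (divides_trans dx xg) dU)).
have [f [_ fS]] := dependent_choice step (exist _ g (conj (divides_refl g) gU)).
have fm i j : divides (sval (f (i + j)%N)) (sval (f i)).
  elim: j => [|j IHj]; first by rewrite addn0; apply: divides_refl.
  by rewrite addnS; apply: divides_trans IHj; have [] := fS (i + j)%N.
pose I : {pred k} := [pred x | `[< exists i, divides (sval (f i)) x >]].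
have I0 : 0 \in I by apply/asboolP; exists 0%N; apply: pdvd0.
have [|h hP] := ideal_generator I0.
  move=> r x y /asboolP[i xi] /asboolP[j yj]; apply/asboolP; exists (i + j)%N.
  apply: pdvdD; first by apply: pdvdZ; apply: divides_trans (fm i j) xi.
  by rewrite addnC; apply: divides_trans (fm j i) yj.
have /hP /asboolP[i hi] := divides_refl h.
have [_ []] := fS i; apply: divides_trans hi _; apply/hP/asboolP.
by exists i.+1; apply: divides_refl.
Qed.

Lemma principal_maximal_ideal p :
    ~ divides p 1 -> (forall d, divides d p -> ~ divides d 1 -> divides p d) ->
  exists m : idealr k, maximal_ideal m /\ forall x, x \in m <-> divides p x.
Proof.
move=> pU pM; pose S : k -> bool := fun x => `[< divides p x >].
have SP : idealr_closed S.
  split; [by apply/asboolP; apply: pdvd0 | by apply/asboolP |].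
  move=> a x y /asboolP px /asboolP py; apply/asboolP.
  by apply: pdvdD => //; apply: pdvdZ.
pose L := isIdealr.Build k S SP.
pose m : idealr k := HB.pack_for (idealr k) S L.
have mP x : x \in m <-> divides p x by split=> /asboolP.
exists m; split=> // I mI x.
apply/idP/idP => [xI|]; last exact: mI.
have [|q qP] := ideal_generator (idealr0 I).
  by move=> r y z yI zI; rewrite rpredD // idealMr.
have qU : ~ divides q 1 by move=> /qP; rewrite idealr1.
have qp : divides q p by apply/qP/mI/mP; apply: divides_refl.
by apply/mP; apply: divides_trans (pM _ qp qU) _; apply/qP.
Qed.

Lemma maximal_ideal_above g : ~ divides g 1 -> exists p (m : idealr k),
  [/\ divides p g, maximal_ideal m & forall x, x \in m <-> divides p x].
Proof.
move=> /maximal_divisor[p [pg pU pM]].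
by have [m [mM mP]] := principal_maximal_ideal pU pM; exists p, m.
Qed.

End MaximalIdeals.

(** * Reduction modulo a principal ideal *)

Section Reduction.
Variables (k : comNzRingType) (m : idealr k) (p : k).
Hypothesis mP : forall x, x \in m <-> pdvd (V := k^o) p x.

Local Notation pi := (residue_map m).

Lemma residue_map_eq0 x : pi x = 0 <-> pdvd (V := k^o) p x.
Proof.
rewrite -mP -[x in x \in m]subr0 Quotient.idealrBE -(rmorph0 pi).
by split=> /eqP.
Qed.

Lemma residue_map_surj y : exists x, y = pi x.
Proof. by exists (repr y); rewrite /residue_map /= reprK. Qed.

Section Algebra.
Variable A : finFreeAlgType k.
Implicit Types a b : A.

Local Notation "[ a ]" := (residue_tens m 1 a).

Lemma residue_tensD a b : [a + b] = [a] + [b].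
Proof. by have [h _ _] := tens_balanced pi A; apply: h. Qed.

Lemma residue_tensZ r a : [r *: a] = pi r *: [a].
Proof.
have [_ _ h] := tens_balanced pi A.
by rewrite /residue_tens -h tens_scale.
Qed.

Lemma residue_tensM a b : [a * b] = [a] * [b].
Proof. by rewrite [RHS]tens_mul mulr1. Qed.

Lemma residue_tens_sum n (a : 'I_n -> A) : [\sum_i a i] = \sum_i [a i].
Proof.
apply: (big_morph _ residue_tensD); apply: (addrI [0]).
by rewrite -residue_tensD !addr0.
Qed.

Lemma residue_tens_surj (x : residue_algebra m A) : exists a, x = [a].
Proof.
have [s ->] := tens_span x; elim: s => [|[f a] s [b IHs]].
  exists 0; rewrite big_nil; apply: (addrI [0]).
  by rewrite -residue_tensD !addr0.
have [r rE] := residue_map_surj f.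
exists (r *: a + b); rewrite big_cons residue_tensD residue_tensZ -IHs /=.
by rewrite [in RHS]tens_scale mulr1 rE.
Qed.

(** If 1 (x) a = 0, the coordinates of a in a basis vanish in the residue
    ring, so they are divisible by p. *)
Lemma residue_tens_eq0 a : [a] = 0 <-> pdvd p a.
Proof.
split=> [a0|[b ->]]; last first.
  rewrite residue_tensZ (_ : pi p = 0) ?scale0r //.
  by apply/residue_map_eq0; exists 1; rewrite /GRing.scale /= mulr1.
have [n [b [co [cob _ coE]]]] := coord_balanced pi A.
have [c [aE cE]] := coE a; rewrite aE; apply: pdvd_sum => i.
have /residue_map_eq0[d ->] : pi (c i) = 0.
  rewrite -cE; have := congr1 (bc_lift (fun f a => f * co i a)) a0.
  by rewrite (bc_lift_tens (cob i)) mul1r => ->; apply: (bc_lift0 (cob i)).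
by exists (d *: b i); rewrite scalerA.
Qed.

Lemma residue_tens_eq a b : [a] = [b] <-> pdvd p (a - b).
Proof.
have bE : [a] = [a - b] + [b] by rewrite -residue_tensD subrK.
rewrite -residue_tens_eq0 bE; split=> [/eqP|->]; last by rewrite add0r.
by rewrite -[X in _ == X]add0r => /eqP/addIr.
Qed.

(** The form s lifts the symmetrizing form of the residue algebra: its values
    on a basis are lifts of the values of that form. *)
Lemma residue_symmetric : symmetric_algebra (residue_algebra m A) ->
  exists s : {linear A -> k^o},
    (forall a b, pdvd p (s (a * b) - s (b * a))) /\
    (forall a, (forall b, pdvd p (s (a * b))) -> pdvd p a).
Proof.
move=> [t [tC tP]].
have [n [b [bS bL]]] := linear_form_on_basis A.
have /boolp.choice[u uE] i : exists u, t [b i] = pi u.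
  exact: residue_map_surj.
have [s sb] := bL u.
have sE a : t [a] = pi (s a).
  have [c ->] := bS a; rewrite residue_tens_sum !linear_sum rmorph_sum /=.
  apply: eq_bigr => i _.
  by rewrite residue_tensZ !linearZ rmorphM /= uE sb.
have sP a : pdvd p (s a) <-> t [a] = 0 by rewrite sE residue_map_eq0.
exists s; split=> [a c|a h].
  by apply/residue_map_eq0; rewrite rmorphB -!sE !residue_tensM tC subrr.
apply/residue_tens_eq0.
apply: (symmetrizing_form_inj (conj tC tP)) => y.
have [c ->] := residue_tens_surj y.
by rewrite mul0r linear0 -residue_tensM; apply/sP.
Qed.

(** Congruences modulo p in A are equalities in the residue algebra, whose
    elements are all of the form 1 (x) c. *)
Lemma residue_quasi_unit a z : quasi_unit [a] ->
    (forall b, pdvd p (z * b - b * z)) -> (exists b, pdvd p (a - b * z)) ->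
  exists w, pdvd p (w * z - 1).
Proof.
move=> aU zC [b ab].
have [||y [yz _]] := aU [z].
- move=> x; have [c ->] := residue_tens_surj x.
  by rewrite -!residue_tensM; apply/residue_tens_eq.
- by exists [b]; rewrite -residue_tensM; apply/residue_tens_eq.
have [w wE] := residue_tens_surj y; exists w; apply/residue_tens_eq.
by rewrite residue_tensM -wE.
Qed.

End Algebra.

Hypothesis m_max : maximal_ideal m.

(** The ideal generated by m and x is not contained in m, so it cannot be
    proper. *)
Lemma residue_inverse x : ~ pdvd (V := k^o) p x ->
  exists y, pdvd (V := k^o) p (y * x - 1).
Proof.
move=> xp; apply: contrapT => noy.
pose S : k -> bool := fun z => `[< exists y, pdvd (V := k^o) p (z - y * x) >].
have SP : idealr_closed S.
  split.
  - by apply/asboolP; exists 0; rewrite mul0r subr0; apply: pdvd0.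
  - apply/asboolP=> -[y py]; apply: noy; exists y.
    by rewrite -opprB; apply: pdvdN.
  - move=> a u v /asboolP[y py] /asboolP[z pz]; apply/asboolP.
    exists (a * y + z); rewrite mulrDl opprD addrACA -mulrA -mulrBr.
    by apply: pdvdD => //; apply: pdvdZ.
pose L := isIdealr.Build k S SP.
pose I : idealr k := HB.pack_for (idealr k) S L.
have Im : {subset m <= I}.
  by move=> z /mP pz; apply/asboolP; exists 0; rewrite mul0r subr0.
apply: xp; apply/mP; rewrite -(m_max Im); apply/asboolP; exists 1.
by rewrite mul1r subrr; apply: pdvd0.
Qed.

(** The residue ring of a maximal ideal, repackaged as a field so that linear
    algebra applies to it. *)
Lemma residue_field : exists (F : fieldType) (f : {rmorphism k -> F}),
  (forall y, exists x, y = f x) /\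
  (forall x, f x = 0 <-> pdvd (V := k^o) p x).
Proof.
have /boolp.choice[iv ivP] (y : {ideal_quot m}) :
    exists z, (y != 0 -> z * y = 1) /\ (y = 0 -> z = 0).
  have [->|y0] := eqVneq y 0; first by exists 0.
  have [x xE] := residue_map_surj y.
  have [|z pz] := @residue_inverse x.
    by move=> /residue_map_eq0 x0; rewrite xE x0 eqxx in y0.
  exists (pi z); split=> [_|/eqP]; last by rewrite (negPf y0).
  rewrite xE -rmorphM -(rmorph1 pi); apply/eqP.
  by rewrite -subr_eq0 -rmorphB; apply/eqP/residue_map_eq0.
have ivM : forall y, y != 0 -> iv y * y = 1 by move=> y /(proj1 (ivP y)).
have iv0 : iv 0 = 0 by apply: (proj2 (ivP 0)).
pose L := GRing.ComNzRing_isField.Build {ideal_quot m} ivM iv0.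
pose F : fieldType := HB.pack_for fieldType {ideal_quot m} L.
exists F, (residue_map m); split; first exact: residue_map_surj.
exact: residue_map_eq0.
Qed.

(** Duality over the residue field: if the coordinate vector of x is
    outside the row space of the matrix of right multiplication by z, a column
    of the cokernel of that matrix detects it, and lifting the column to k
    gives the values of f on a basis. *)
Lemma residue_separation (A : finFreeAlgType k) (z x : A) :
    (exists a, pdvd p (x - a * z)) \/
  exists f : {linear A -> k^o},
    (forall a, pdvd p (f (a * z))) /\ ~ pdvd p (f x).
Proof.
have [F [f [f_surj f_eq0]]] := residue_field.
have [n [b [c [bE cb]]]] := dual_basis A.
pose M := \matrix_(i, j) f (c j (b i * z)).
pose v := \row_j f (c j x).
have pdvdP a : (forall j, f (c j a) = 0) -> pdvd p a.
  move=> a0; rewrite (bE a); apply: pdvd_sum => i.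
  by have /f_eq0[d ->] := a0 i; exists (d *: b i); rewrite scalerA.
have [/submxP[w wE]|] := boolP (v <= M)%MS.
  left; have /boolp.choice[u uE] i := f_surj (w 0 i).
  exists (\sum_i u i *: b i); apply: pdvdP => j.
  have := congr1 (fun r : 'rV_n => r 0 j) wE; rewrite !mxE => xE.
  rewrite linearB rmorphB /= xE mulr_suml linear_sum rmorph_sum /=.
  apply/eqP; rewrite subr_eq0; apply/eqP; apply: eq_bigr => i _.
  by rewrite -scalerAl linearZ rmorphM /= -uE mxE.
rewrite submxE => /rV0Pn[j vj]; right.
have /boolp.choice[u uE] i := f_surj (cokermx M i j).
have [|g gE] := @linear_form_of _ A (fun a => \sum_i c i a * u i).
  move=> r a a'; rewrite mulr_sumr -big_split; apply: eq_bigr => i _ /=.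
  by rewrite linearD linearZ mulrDl mulrA.
have fgE a : f (g a) = \sum_i f (c i a) * cokermx M i j.
  by rewrite gE rmorph_sum; apply: eq_bigr => i _; rewrite rmorphM /= uE.
exists g; split=> [a|].
  rewrite {1}(bE a) mulr_suml linear_sum; apply: pdvd_sum => i.
  rewrite -scalerAl linearZ; apply: pdvdZ; apply/f_eq0; rewrite fgE.
  have := congr1 (fun r : 'M_n => r i j) (mulmx_coker M); rewrite !mxE.
  move=> e; apply: etrans e; apply: eq_bigr => l _; congr (_ * _).
  by rewrite mxE; reflexivity.
move=> /f_eq0 gx; case/eqP: vj; rewrite mxE; apply: etrans gx; rewrite fgE.
by apply: eq_bigr => l _; congr (_ * _); rewrite mxE; reflexivity.
Qed.

End Reduction.

(** * Homogeneous components of a graded algebra *)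

Section Parts.
Variables (R : comNzRingType) (A : algType R) (N : nat) (Ag : grading A N).
Implicit Types (x y : A) (i j : nat).

(** Indexed by all natural numbers, as the components of a grading are; this is
    the homogeneous component when i <= N and zero beyond. *)
Definition part i x : A :=
  if insub i is Some i' then sval (cid (component_direct Ag x)) i' else 0.

Lemma part_ord (i : 'I_N.+1) x :
  part i x = sval (cid (component_direct Ag x)) i.
Proof. by rewrite /part valK. Qed.

Lemma part_mem i x : part i x \in Ag i.
Proof.
rewrite /part; case: insubP => [u _ <-|_]; last exact: rpred0.
by case: cid => s [[sA _] _] /=; apply: sA.
Qed.

Lemma part_gt i x : (N < i)%N -> part i x = 0.
Proof. by move=> iN; apply: (component_gt (g := Ag) iN); apply: part_mem. Qed.

Lemma part_sum x : x = \sum_(i < N.+1) part i x.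
Proof.
under eq_bigr => i _ do rewrite part_ord.
by case: cid => s [[_ xE] _] /=.
Qed.

Lemma part_unique (f : nat -> A) x :
    (forall i, f i \in Ag i) -> x = \sum_(i < N.+1) f i ->
  forall i, part i x = f i.
Proof.
move=> fA xE i; case: (ltnP N i) => iN.
  by rewrite part_gt // (component_gt iN (fA i)).
rewrite (part_ord (Ordinal (iN : i < N.+1)%N)); case: cid => s [[_ _] sU] /=.
rewrite (sU [ffun j : 'I_N.+1 => f j]) ?ffunE //; split=> [j|].
  by rewrite ffunE.
by rewrite {1}xE; apply: eq_bigr => j _; rewrite ffunE.
Qed.

Fact part_is_linear i : linear (part i).
Proof.
move=> r x y; apply: (@part_unique (fun i => r *: part i x + part i y)).
  by move=> j; rewrite rpredD ?rpredZ ?part_mem.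
by rewrite {1}[x]part_sum {1}[y]part_sum scaler_sumr -big_split.
Qed.

HB.instance Definition _ i :=
  GRing.isLinear.Build R A A *:%R (part i) (part_is_linear i).

Lemma part_homog i j x : x \in Ag i -> part j x = if j == i then x else 0.
Proof.
move=> xi; case: (ltnP N i) => iN.
  by rewrite (component_gt iN xi) linear0 if_same.
apply: (@part_unique (fun j => if j == i then x else 0)) => [l|].
  by case: eqP => [->|_] //; apply: rpred0.
rewrite (bigD1 (Ordinal (iN : i < N.+1)%N)) //= eqxx big1 ?addr0 // => l.
by move=> /negPf; rewrite -val_eqE /= => ->.
Qed.

Lemma part_id i x : x \in Ag i -> part i x = x.
Proof. by move=> /part_homog->; rewrite eqxx. Qed.

Lemma homogP i x : x \in Ag i <-> part i x = x.
Proof. by split=> [/part_id //|<-]; apply: part_mem. Qed.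

Lemma partM0r i a x : a \in Ag 0%N -> part i (x * a) = part i x * a.
Proof.
move=> a0; move: i; apply: (@part_unique (fun i => part i x * a)).
  by move=> i; rewrite -[i in Ag i]addn0; apply: (componentM (part_mem i x)).
by rewrite {1}[x]part_sum mulr_suml.
Qed.

Lemma part0Ml a x : a \in Ag 0%N -> part 0 (a * x) = a * part 0 x.
Proof.
move=> a0; apply: (@part_unique (fun i => a * part i x)).
  by move=> i; apply: (componentM a0 (part_mem i x)).
by rewrite {1}[x]part_sum mulr_sumr.
Qed.

(** The filtration by lowest degree. *)
Definition degree_ge i x := forall j, (j < i)%N -> part j x = 0.

Lemma degree_geM i j x y :
  degree_ge i x -> degree_ge j y -> degree_ge (i + j) (x * y).
Proof.
move=> xi yj l lij.
rewrite [x]part_sum [y]part_sum mulr_suml linear_sum big1 // => a _.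
rewrite mulr_sumr linear_sum big1 // => b _ /=.
have [ai|ia] := ltnP a i; first by rewrite xi // mul0r linear0.
have [bj|jb] := ltnP b j; first by rewrite yj // mulr0 linear0.
rewrite (part_homog _ (componentM (part_mem a x) (part_mem b y))).
by rewrite ltn_eqF // (leq_trans lij) // leq_add.
Qed.

Lemma degree_ge_eq0 i x : (N < i)%N -> degree_ge i x -> x = 0.
Proof.
move=> iN xi; rewrite [x]part_sum big1 // => j _.
by apply: xi; apply: leq_trans iN.
Qed.

Lemma degree_ge_homog i x : x \in Ag i -> degree_ge i x.
Proof. by move=> xi j ji; rewrite (part_homog _ xi) ltn_eqF. Qed.

Lemma degree_ge1 x : degree_ge 1 (x - part 0 x).
Proof.
by case=> // _; rewrite linearB /= (part_id (part_mem 0 x)) subrr.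
Qed.

Lemma degree_geX x n : degree_ge 1 x -> degree_ge n (x ^+ n).
Proof.
move=> x1; elim: n => [|n IHn] //.
by rewrite exprS -[n.+1]add1n; apply: degree_geM.
Qed.

Lemma degree_ge1_nilpotent x : degree_ge 1 x -> x ^+ N.+1 = 0.
Proof. by move=> x1; apply: (@degree_ge_eq0 N.+1) => //; apply: degree_geX. Qed.

(** A product of an element of degree N with one of positive degree is zero. *)
Lemma mul_topl y x : y \in Ag N -> y * x = y * part 0 x.
Proof.
move=> yN; apply/eqP; rewrite -subr_eq0 -mulrBr; apply/eqP.
apply: (@degree_ge_eq0 (N + 1)); first by rewrite addn1.
by apply: degree_geM (degree_ge1 x); apply: degree_ge_homog.
Qed.

End Parts.

Lemma part_subalgebra (R : comNzRingType) (A : algType R) N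
    (Ag : grading A N) (B : finFreeSubalgClosed A) i x :
  graded_subalgebra Ag B -> x \in B -> part Ag i x \in B.
Proof.
move=> BP /BP[s [sB ->]]; rewrite linear_sum rpred_sum // => j _ /=.
have /andP[sjB sjA] := sB j.
by rewrite (part_homog _ sjA); case: ifP => _ //; apply: rpred0.
Qed.

(** * Torsion and saturation *)

Lemma fin_free_torsion_free (k : idomainType) (A : finFreeAlgType k) (p : k)
    (x y : A) : p != 0 -> p *: x = p *: y -> x = y.
Proof.
move=> p0 e; have [n [b [c [bE _]]]] := dual_basis A.
rewrite [x]bE [y]bE; apply: eq_bigr => i _; congr (_ *: _).
by apply: (mulfI p0); have := congr1 (c i) e; rewrite !linearZ.
Qed.

Lemma homog_saturated (k : idomainType) (A : finFreeAlgType k) N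
    (Ag : grading A N) i (p : k) (x : A) :
  p != 0 -> p *: x \in Ag i -> x \in Ag i.
Proof.
move=> p0 /part_id e; apply/homogP; apply: (fin_free_torsion_free p0).
by rewrite -linearZ.
Qed.

(** The determinant d of the matrix X expressing a basis of U in a basis of W is
    nonzero because the basis of U is independent, and the adjugate of X
    expresses d times the basis of W in the basis of U. *)
Lemma same_rank_torsion (k : idomainType) (V : lmodType k) (U : submodClosed V)
    (W : {pred V}) n :
    {subset U <= W} -> free_of_rank U n -> free_of_rank W n ->
  exists2 r : k, r != 0 & forall x, x \in W -> r *: x \in U.
Proof.
move=> UW [b [bU bP]] [e [eW eP]].
have /boolp.choice[M ME] i :
    exists c : {ffun 'I_n -> k}, b i = \sum_j c j *: e j.
  by have [c [cE _]] := eP _ (UW _ (bU i)); exists c.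
pose X := \matrix_(i, j) M i j.
have XE (v : 'rV_n) : \sum_i v 0 i *: b i = \sum_j (v *m X) 0 j *: e j.
  under eq_bigr => i _ do rewrite ME scaler_sumr.
  rewrite exchange_big; apply: eq_bigr => j _ /=.
  by rewrite mxE scaler_suml; apply: eq_bigr => i _; rewrite scalerA mxE.
exists (\det X).
  apply/det0P=> -[v v0 vX]; case/eqP: v0; apply/rowP => i; rewrite mxE.
  have [c [_ cU]] := bP _ (rpred0 U).
  have c0 : c = [ffun=> 0].
    by apply: cU; rewrite big1 // => j _; rewrite ffunE scale0r.
  have cv : c = [ffun i => v 0 i].
    apply: cU; under eq_bigr => j _ do rewrite ffunE.
    by rewrite XE vX big1 // => j _; rewrite mxE scale0r.
  have := congr1 (fun f : {ffun _} => f i) (etrans (esym cv) c0).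
  by rewrite !ffunE.
have eU j : \det X *: e j \in U.
  suff -> : \det X *: e j = \sum_i (row j (\adj X)) 0 i *: b i.
    by rewrite rpred_sum // => i _; rewrite rpredZ.
  rewrite XE -row_mul mul_adj_mx (bigD1 j) //= big1 ?addr0 => [|i ij].
    by rewrite !mxE eqxx.
  by rewrite !mxE eq_sym (negPf ij) scale0r.
move=> x /eP[c [-> _]]; rewrite scaler_sumr rpred_sum // => j _.
by rewrite scalerA mulrC -scalerA rpredZ.
Qed.

Section FullRank.
Variables (k : idomainType) (S : algType k) (N : nat) (Sg : grading S N).
Variable T : finFreeSubalgClosed S.

Fact sub_component_submod i : GRing.submod_closed (sub_component Sg T i).
Proof.
split=> [|a x y /andP[xT xi] /andP[yT yi]]; rewrite inE ?rpred0 //.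
by rewrite !(rpredD, rpredZ).
Qed.

HB.instance Definition _ i := GRing.isSubmodClosed.Build k S
  (sub_component Sg T i) (sub_component_submod i).

Lemma full_rank_torsion x : full_rank Sg T ->
  exists2 r, r != 0 & r *: x \in T.
Proof.
move=> TS; suff [r r0 rP] : exists2 r, r != 0 &
    forall i : 'I_N.+1, r *: part Sg i x \in T.
  exists r => //; rewrite [x](part_sum Sg) scaler_sumr rpred_sum // => i _.
have /boolp.choice[r rP] (i : 'I_N.+1) :
    exists r, r != 0 /\ r *: part Sg i x \in T.
  have [n [Tn Sn]] := TS i (ltn_ord i).
  have [|r r0 rP] := same_rank_torsion _ Tn Sn; first by move=> y /andP[].
  by exists r; split=> //; have /andP[] := rP _ (part_mem Sg i x).
exists (\prod_i r i) => [|i].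
  by apply/prodf_neq0 => i _; have [] := rP i.
by rewrite (bigD1 i) //= mulrC -scalerA rpredZ //; have [] := rP i.
Qed.

End FullRank.

(** * Reduction modulo p of T and C *)

Section Saturation.
Variables (k : idomainType) (m : idealr k) (p : k).
Hypothesis mP : forall x, x \in m <-> pdvd (V := k^o) p x.
Hypotheses (m_max : maximal_ideal m) (p_neq0 : p != 0).
Variables (S : finFreeAlgType k) (N : nat) (Sg : grading S N).
Variable T : finFreeSubalgClosed S.
Hypothesis T_graded : graded_subalgebra Sg T.
Hypothesis T0_eq_S0 : sub_component Sg T 0 =i Sg 0%N.
Variable t : {linear subalg T -> k^o}.
Hypothesis t_sym : degree_opp_symmetrizing_form Sg t.
Variable C : finFreeSubalgClosed S.
Hypothesis T_sub_C : {subset T <= C}.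
(* A lift to k of the symmetrizing form of the residue algebra of C. *)
Variable s : {linear subalg C -> k^o}.
Hypothesis s_sym : forall a b, pdvd (V := k^o) p (s (a * b) - s (b * a)).
Hypothesis s_ndeg :
  forall a, (forall b, pdvd (V := k^o) p (s (a * b))) -> pdvd p a.

Local Notation S0 := (subalg (degree0_subalg Sg)).

Definition incl (x : subalg T) : subalg C := Subalg (T_sub_C (valP x)).

Fact degree0_mem (a : S0) : \val a \in Sg 0%N.
Proof. exact: valP a. Qed.

Fact degree0_sub (a : S0) : \val a \in T.
Proof. by have := degree0_mem a; rewrite -T0_eq_S0 => /andP[]. Qed.

Definition incl0 (a : S0) : subalg T := Subalg (degree0_sub a).

Definition proj0 (x : S) : S0 :=
  @Subalg _ _ (degree0_subalg Sg) (part Sg 0 x) (part_mem Sg 0 x).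

Definition sub_part i (x : subalg T) : subalg T :=
  Subalg (part_subalgebra i T_graded (valP x)).

Let t_tr : forall x y, t (x * y) = t (y * x) := proj1 (proj1 t_sym).

Lemma proj0_incl0 a : proj0 (val (incl0 a)) = a.
Proof. by apply: val_inj => /=; apply: part_id; apply: degree0_mem. Qed.

(** The form t vanishes in degrees other than N. *)
Lemma form_top x : t x = t (sub_part N x).
Proof.
have xE : x = \sum_(i < N.+1) sub_part i x.
  by apply: val_inj; rewrite raddf_sum {1}[\val x](part_sum Sg).
rewrite {1}xE linear_sum (bigD1 ord_max) //= big1 ?addr0 // => i iN.
by apply: (proj2 t_sym i); [apply/eqP | apply: part_mem].
Qed.

(** Since t is perfect over k, the restriction of s to T is represented by an
    element of T itself and not only modulo p. *)
Lemma trace_multiplier : exists z, forall x, s (incl x) = t (z * x).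
Proof.
have [|f fE] := @linear_form_of k (subalg T) (fun x => s (incl x)).
  move=> r x y; rewrite -linearP; congr (s _).
  exact: val_inj.
by have [z [zE _]] := proj2 (proj1 t_sym) f; exists z => x; rewrite zE fE.
Qed.

Variable z : subalg T.
Hypothesis zP : forall x, s (incl x) = t (z * x).

Let z0 := proj0 (val z).

(** Both s and t are trace forms, so t ((z * x - x * z) * y) equals
    s (x * y) - s (y * x), which vanishes modulo p for all y. *)
Lemma multiplier_central x : pdvd p (z * x - x * z).
Proof.
apply: (symmetrizing_form_pdvd (proj1 t_sym)) => y.
rewrite mulrBl linearB /= -mulrA -[x * z * y]mulrA (t_tr x) -mulrA -!zP.
have inclM a b : incl (a * b) = incl a * incl b by apply: val_inj.
by rewrite !inclM; apply: s_sym.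
Qed.

Lemma multiplier0_central (b : S0) : pdvd p (z0 * b - b * z0).
Proof.
have [w wE] := multiplier_central (incl0 b); exists (proj0 (val w)).
apply: val_inj; have := congr1 (fun x => part Sg 0 (val x)) wE.
have b0 := degree0_mem b.
by rewrite /= linearB linearZ /= (part0Ml _ b0) (partM0r _ _ b0).
Qed.

Lemma top_mul0 (y x : subalg T) :
  val y \in Sg N -> y * x = y * incl0 (proj0 (val x)).
Proof. by move=> yN; apply: val_inj; apply: mul_topl. Qed.

Variable xi : S0.
Hypothesis top_decomp : forall y, y \in Sg N ->
     exists y1 y2, [/\ y = y1 + y2, \val xi * y1 = 0 &
                       y2 \in sub_component Sg T N].

(** Suppose not.  A form L on S^0 that separates xi from S^0 z0 modulo p,
    composed with the projection to degree zero, equals t (y * _) on T.  Let Y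
    be the degree N part of y.  On Y T the form s takes the values
    L (a * z0), all divisible by p, so s vanishes modulo p on Y C as well, and
    Y is p times an element of C of degree N.  Then L xi = t (xi * Y) is
    divisible by p by the decomposition of that element. *)
Lemma xi_multiple : exists b, pdvd p (xi - b * z0).
Proof.
have [//|[L [Lz0 Lxi]]] := residue_separation mP m_max z0 xi; case: Lxi.
have [|f fE] := @linear_form_of k (subalg T) (fun x => L (proj0 (val x))).
  move=> r x y; rewrite -linearP; congr (L _); apply: val_inj => /=.
  by rewrite linearP.
have [y [yE _]] := proj2 (proj1 t_sym) f.
pose Y := sub_part N y.
have YN : val Y \in Sg N by apply: part_mem.
have tY a : t (Y * incl0 a) = L a.
  rewrite -[a in RHS]proj0_incl0 -fE -yE [RHS]form_top; congr (t _).
  by apply: val_inj; rewrite /= (partM0r _ _ (degree0_mem a)).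
have sY x : pdvd (V := k^o) p (s (incl (Y * incl0 x))).
  rewrite zP t_tr (@top_mul0 (Y * incl0 x)); last first.
    by have := componentM YN (degree0_mem x); rewrite addn0.
  rewrite -/z0.
  suff -> : Y * incl0 x * incl0 z0 = Y * incl0 (x * z0) by rewrite tY.
  by apply: val_inj; rewrite /= mulrA.
have [c cE] : pdvd p (incl Y).
  apply: s_ndeg => c.
  suff -> : incl Y * c = incl (Y * incl0 (proj0 (val c))) by [].
  by apply: val_inj; apply: mul_topl.
have {}cE : val Y = p *: val c by rewrite -[LHS]/(val (incl Y)) cE.
have cN : val c \in Sg N by apply: (homog_saturated p_neq0); rewrite -cE.
have [y1 [y2 [c12 xy1 /andP[y2T _]]]] := top_decomp cN.
rewrite -tY t_tr.
have -> : incl0 xi * Y = p *: (incl0 xi * Subalg y2T).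
  apply: val_inj; rewrite -[LHS]/(\val xi * \val Y).
  by rewrite cE c12 -scalerAr mulrDr xy1 add0r.
by rewrite linearZ; apply: pdvd_scale.
Qed.

Hypothesis xi_quasi_unit : quasi_unit (residue_tens m 1 xi).

(** Let w * z0 be 1 modulo p.  Then w * z is 1 - n modulo p, where n has
    positive degree and so is nilpotent.  If x is divisible by p in C, then
    z * x is divisible by p in T by nondegeneracy of t, so x is congruent to
    n * x, and therefore to n ^+ j * x for all j. *)
Lemma saturated (x : subalg T) : pdvd p (incl x) -> pdvd p x.
Proof.
move=> xC.
have [w wz] :=
  residue_quasi_unit mP xi_quasi_unit multiplier0_central xi_multiple.
have zx : pdvd p (z * x).
  apply: (symmetrizing_form_pdvd (proj1 t_sym)) => y; rewrite -mulrA -zP.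
  have [c cE] := xC; apply: pdvd_linear; exists (c * incl y).
  rewrite scalerAl -cE; exact: val_inj.
pose n := - (incl0 w * (z - incl0 z0)).
have n_nil : n ^+ N.+1 = 0.
  apply: val_inj; rewrite rmorphXn; apply: (@degree_ge1_nilpotent _ _ _ Sg).
  rewrite -[1%N]add0n rmorphN rmorphM -mulNr; apply: degree_geM => //.
  exact: degree_ge1.
have nx : pdvd p (x - n * x).
  have -> : x - n * x = incl0 w * (z * x) - (incl0 w * incl0 z0 - 1) * x.
    rewrite /n mulNr opprK mulrBl mul1r mulrA mulrBr mulrBl opprB addrCA.
    by rewrite addrA addrC addrA.
  apply: pdvdB; first exact: pdvd_mull.
  have [u uE] := wz; exists (incl0 u * x); rewrite scalerAl; congr (_ * _).
  by apply: val_inj; have := congr1 val uE.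
suff /(_ N.+1) : forall j, pdvd p (x - n ^+ j * x) by rewrite n_nil mul0r subr0.
elim=> [|j IHj]; first by rewrite mul1r subrr; apply: pdvd0.
have -> : x - n ^+ j.+1 * x = (x - n * x) + n * (x - n ^+ j * x).
  by rewrite mulrBr addrA subrK mulrA exprS.
by apply: pdvdD => //; apply: pdvd_mull.
Qed.

End Saturation.

Theorem mainTheorem1
  (k : idomainType) (k_pid : principal_ideal_ring k)
  (k_char0 : [pchar {fraction k}] =i pred0)
  (S : finFreeAlgType k) (N : nat) (Sg : grading S N)
  (T : finFreeSubalgClosed S)
  (T_graded : graded_subalgebra Sg T)
  (T_full_rank : full_rank Sg T)
  (T0_eq_S0 : sub_component Sg T 0 =i Sg 0%N)
  (T_sym : exists t : {linear subalg T -> k^o},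
     degree_opp_symmetrizing_form Sg t)
  (C : finFreeSubalgClosed S)
  (T_sub_C : {subset T <= C})
  (C_sym : forall m : idealr k, maximal_ideal m ->
     symmetric_algebra (residue_algebra m (subalg C)))
  (xi : subalg (degree0_subalg Sg))
  (top_decomp : forall y, y \in Sg N ->
     exists y1 y2, [/\ y = y1 + y2, \val xi * y1 = 0 &
                       y2 \in sub_component Sg T N])
  (xi_quasi_unit : forall m : idealr k, maximal_ideal m ->
     quasi_unit (residue_tens m 1 xi)) :
  C =i T.
Proof.
move=> c; apply/idP/idP=> [cC|]; last exact: T_sub_C.
have [r r0 rcT] := full_rank_torsion c T_full_rank.
pose I : {pred k} := [pred a | a *: c \in T].
have [||g gP] := @ideal_generator k k_pid I.
- by rewrite inE scale0r rpred0.
- by move=> a x y xI yI; rewrite inE scalerDl -scalerA rpredD // rpredZ.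
have [u rE] : pdvd (V := k^o) g r by apply/gP.
have g0 : g != 0 by apply: contraNneq r0 => g0; rewrite rE g0 scale0r.
apply: contrapT => cT.
have [|p [m [[h hE] m_max mP]]] := @maximal_ideal_above k k_pid g.
  by move=> g1; apply: cT; have := proj2 (gP 1) g1; rewrite inE scale1r.
have p0 : p != 0 by apply: contraNneq g0 => p0; rewrite hE p0 scale0r.
have gcT : g *: c \in T by apply/gP; apply: divides_refl.
have [t tP] := T_sym.
have [s [s_sym s_ndeg]] := residue_symmetric mP (C_sym m m_max).
have [z zP] := trace_multiplier tP T_sub_C s.
(* With g = p * h, the element h *: c of C has its p-multiple in T. *)
have gcC : pdvd p (incl T_sub_C (Subalg gcT)).
  have hcC : h *: c \in C by rewrite rpredZ.
  by exists (Subalg hcC); apply: val_inj; rewrite /= scalerA -[p * h]hE.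
have [y yE] := saturated mP m_max p0 T_graded T0_eq_S0 tP s_sym s_ndeg zP
  top_decomp (xi_quasi_unit m m_max) gcC.
have hcT : h *: c \in T.
  suff -> : h *: c = \val y by apply: valP.
  apply: (fin_free_torsion_free p0); rewrite scalerA -[p * h]hE.
  exact: (congr1 val yE).
(* So g = p * h divides h, and p is a unit. *)
have [v hv] : pdvd (V := k^o) g h by apply/gP.
have : 1 \in m.
  apply/mP; exists v; apply: (mulfI g0).
  by rewrite mulr1 {1}hE hv /GRing.scale /= mulrCA.
by rewrite idealr1.
Qed.
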